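(* Let $A\subset\mathbb{R}^p$ be a $d$-regular compact set, where $0<d\leqslant p$, and let $f$ be a $d$-Riesz-like function. If $(\nu_N)_{N=1}^\infty$ is a sequence of measures on $A$ with $\nu_N\stackrel{*}{\to}\nu$ as $N\to\infty$, then $P_f(\nu_N)\to P_f(\nu)$ as $N\to\infty$.
   Context: All measures are finite positive Borel measures supported on $A$. $d$-regular: a nonempty compact set $A\subset\mathbb{R}^p$ with $\operatorname{diam}(A)>0$ is called $d$-regular, $0<d\leqslant p$, if there exist positive constants $c$ and $C$ such that for any $y\in A$ and any $r$ with $0<r<\operatorname{diam}(A)$ we have $cr^d\leqslant\mathcal{H}_d(B(y,r)\cap A)\leqslant Cr^d$. Here $\mathcal{H}_d$ is the $d$-dimensional Hausdorff measure on $\mathbb{R}^p$ normalized by $\mathcal{H}_d([0,1]^d)=1$, and $B(y,r)$ is the open ball in $\mathbb{R}^p$ with center $y$ and radius $r$. $d$-Riesz-like: a function $f\colon(0,\infty)\to(0,\infty)$ is called $d$-Riesz-like if it is continuous, strictly decreasing, and for some $\varepsilon$ with $0<\varepsilon<d$ and some $t_\varepsilon>0$ the function $t\mapsto t^{d-\varepsilon}f(t)$ is increasing on $[0,t_\varepsilon]$, where its value at $0$ is defined as $\lim_{t\to0^+}t^{d-\varepsilon}f(t)$. We set $f(0):=\lim_{t\to0^+}f(t)\in(0,\infty]$. Potential and polarization: for a measure $\mu$ on $A$, $U_f^\mu(y):=\int_A f(|x-y|)\,\mathrm{d}\mu(x)$ for $y\in\mathbb{R}^p$, and $P_f(\mu):=\inf_{y\in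 A}U_f^\mu(y)$. Weak$^*$ convergence: $\nu_N\stackrel{*}{\to}\nu$ means that $\int\varphi\,\mathrm{d}\nu_N\to\int\varphi\,\mathrm{d}\nu$ for every function $\varphi$ continuous on $A$. *)

(* Defs.v *)
From HB Require Import structures.
From mathcomp Require Import all_boot all_order all_algebra.
From mathcomp Require Import all_classical all_reals all_analysis.

Set Implicit Arguments.
Unset Strict Implicit.
Unset Printing Implicit Defensive.

Import Order.TTheory GRing.Theory Num.Theory.
Import numFieldNormedType.Exports.

Local Open Scope classical_set_scope.
Local Open Scope ring_scope.

(* The norm of 'rV[R]_p in the library is the sup norm; it has the topology
   of R^p but not its metric, hence the Euclidean norm below. *)
Definition enorm {R : realType} {p : nat} (x : 'rV[R]_p) : R :=
  Num.sqrt (\sum_(i < p) x ord0 i ^+ 2).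

Definition eball {R : realType} {p : nat} (y : 'rV[R]_p) (r : R)
    : set 'rV[R]_p :=
  [set x | enorm (x - y) < r].

(* 0 is added to the set of distances so that the empty set has diameter 0. *)
Definition ediam {R : realType} {p : nat} (E : set 'rV[R]_p) : \bar R :=
  ereal_sup (0%E |` [set (enorm (z.1 - z.2))%:E | z in E `*` E]).

Definition hausdorff_premeasure {R : realType} {p : nat} (d delta : R)
    (E : set 'rV[R]_p) : \bar R :=
  ereal_inf [set (\sum_(0 <= i <oo) (ediam (U i)) `^ d)%E | U in
    [set U : (set 'rV[R]_p)^nat |
      E `<=` \bigcup_i U i /\ forall i, (ediam (U i) <= delta%:E)%E]].

Definition hausdorff_unnormalized {R : realType} {p : nat} (d : R)
    (E : set 'rV[R]_p) : \bar R :=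
  ereal_sup [set hausdorff_premeasure d delta E | delta in [set t : R | 0 < t]].

(* [0,1]^n, embedded in R^p as [0,1]^n x {0}^(p-n) *)
Definition unit_cube {R : realType} {p : nat} (n : nat) : set 'rV[R]_p :=
  [set x : 'rV[R]_p | forall i : 'I_p,
    if (i < n)%N then 0 <= x ord0 i <= 1 else x ord0 i == 0].

(* The normalization H_d([0,1]^d) = 1 only makes sense for integer d, in which
   case the unnormalized measure of the cube is positive and finite; for other
   d the sums of the d-th powers of diameters are left unscaled. *)
Definition hausdorff_cst {R : realType} (p : nat) (d : R) : R :=
  if d \is a Num.nat then
    (fine (hausdorff_unnormalized d (@unit_cube R p (Num.truncn d))))^-1
  else 1.

Definition hausdorff {R : realType} {p : nat} (d : R) (E : set 'rV[R]_p)
    : \bar R :=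
  ((hausdorff_cst p d)%:E * hausdorff_unnormalized d E)%E.

Definition regular_set {R : realType} {p : nat} (d : R) (A : set 'rV[R]_p)
    : Prop :=
  [/\ A !=set0, compact A, (0 < ediam A)%E &
    exists c C : R, [/\ 0 < c, 0 < C &
      forall (y : 'rV[R]_p) (r : R), A y -> 0 < r -> (r%:E < ediam A)%E ->
        ((c * r `^ d)%:E <= hausdorff d (eball y r `&` A) <=
         (C * r `^ d)%:E)%E]].

(* A function on (0,oo) is represented by f : R -> R, whose values outside
   (0,oo) are never used. *)
Definition riesz_like {R : realType} (d : R) (f : R -> R) : Prop :=
  [/\ forall t : R, 0 < t -> 0 < f t,
      forall t : R, 0 < t -> {for t, continuous f},
      forall s t : R, 0 < s -> s < t -> f t < f s &
      exists eps teps : R, [/\ 0 < eps, eps < d, 0 < teps &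
        let g (t : R) := t `^ (d - eps) * f t in
        let g0 (t : R) := if t == 0 then lim (g s @[s --> 0^'+]) else g t in
        {in `[0, teps] &, {homo g0 : s t / s <= t}}]].

Definition kernel0 {R : realType} (f : R -> R) (t : R) : \bar R :=
  if t == 0 then lim ((f s)%:E @[s --> 0^'+]) else (f t)%:E.

Notation borel_rV R p := (g_sigma_algebraType (@open 'rV[R]_p)).

(* The finite Borel measures on a closed set A are those on R^p for which
   the complement of A is null. *)
Definition supported_on {R : realType} {p : nat} (A : set 'rV[R]_p)
    (mu : {finite_measure set (borel_rV R p) -> \bar R}) : Prop :=
  mu (~` A) = 0%E.

Definition potential {R : realType} {p : nat} (A : set 'rV[R]_p) (f : R -> R)
    (mu : {finite_measure set (borel_rV R p) -> \bar R}) (y : 'rV[R]_p)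
    : \bar R :=
  (\int[mu]_(x in A) kernel0 f (enorm ((x : 'rV[R]_p) - y)))%E.

Definition polarization {R : realType} {p : nat} (A : set 'rV[R]_p)
    (f : R -> R) (mu : {finite_measure set (borel_rV R p) -> \bar R})
    : \bar R :=
  ereal_inf [set potential A f mu y | y in A].

Definition weak_star_cvg {R : realType} {p : nat} (A : set 'rV[R]_p)
    (nu_ : nat -> {finite_measure set (borel_rV R p) -> \bar R})
    (nu : {finite_measure set (borel_rV R p) -> \bar R}) : Prop :=
  forall phi : 'rV[R]_p -> R, {within A, continuous phi} ->
    \int[nu_ N]_(x in A) phi x @[N --> \oo] --> \int[nu]_(x in A) phi x.

(* Main.v *)
Require Import Defs.
From HB Require Import structures.
From mathcomp Require Import all_boot all_order all_algebra.
From mathcomp Require Import all_classical all_reals all_analysis.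
From mathcomp Require Import ring lra.

Set Implicit Arguments.
Unset Strict Implicit.
Unset Printing Implicit Defensive.

Import Order.TTheory GRing.Theory Num.Theory.
Import numFieldNormedType.Exports.

Local Open Scope classical_set_scope.
Local Open Scope ring_scope.

(** The two inequalities between the limit and the polarization of the limit are
    of different nature.  Write [V delta mu y] for the potential of [mu] at [y]
    with the kernel frozen at its value at [delta] on [[0, delta]].  These
    potentials are integrals of continuous functions, are continuous in [y] with
    a modulus controlled by the mass of [mu], and increase to the potential of
    [mu] as [delta] decreases to 0.

    Lower bound.  If [M] is below every value on [A] of the potential of [nu],
    then each point of [A] has a neighbourhood on which [M < V delta (nu_ N)] for
    small [delta] and large [N]; by compactness this holds on the whole of [A]
    ([near_truncated_potential_gt]).

    Upper bound.  Weak-star convergence says nothing about the potentials of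
    [nu_ N] at one given point, where their mass may pile up, so a point where
    the potential of [nu] is below [M] need not be good for [nu_ N].  Instead one
    averages over finitely many points [y_1, ..., y_n] of [A] near [y0].  The
    average of the truncated kernels at the [y_i] is bounded, uniformly in the
    truncation, by a continuous function [Phi] with integral less than [M]
    against [nu], hence against [nu_ N] for large [N]
    ([dominating_averages]).  Then some [y_i], depending on [N] and on the
    truncation, has [V delta (nu_ N) y_i < M].  If the polarization of [nu_ N]
    exceeded [M], the compactness argument of the lower bound, applied to the
    constant sequence [nu_ N], would give one [delta] with [M < V delta (nu_ N)]
    on all of [A], a contradiction.

    The function [Phi] comes from regularity. A maximal [delta]-separated subset
    of the ball of radius [r] at [y0] plays the part of the normalized Hausdorff
    measure of that ball: by a packing and a covering argument, a fraction at
    most [K (s / r)^d] of its points is within [s >= delta] of any given point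
    of [A] ([separated_net]). Since [t^(d - eps) f t] increases near 0, halving
    [s] multiplies [f s] by at most [lam < 2^d], so the dyadic sum over
    distances is geometric and the average of the kernel at [x] is at most a
    constant times [f (max |x - y0| r)] ([kernel_average_bound]). The constant
    is harmless: the bound is only needed for [x] close to [y0], and when [f] is
    unbounded the part of the potential at [y0] that comes from there is small.
    When [f] is bounded, [y0] alone serves instead of an average. *)

(** * The Euclidean norm *)

Section EuclideanNorm.
Context {R : realType} {p : nat}.
Implicit Types (x y z : 'rV[R]_p).

Lemma enorm_ge0 x : 0 <= enorm x.
Proof. exact: sqrtr_ge0. Qed.

Lemma sqr_enorm x : enorm x ^+ 2 = \sum_(i < p) x ord0 i ^+ 2.
Proof. by rewrite sqr_sqrtr// sumr_ge0// => i _; exact: sqr_ge0. Qed.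

Lemma enormN x : enorm (- x) = enorm x.
Proof.
by rewrite /enorm; congr Num.sqrt; apply: eq_bigr => i _; rewrite mxE sqrrN.
Qed.

Lemma enorm0 : enorm (0 : 'rV[R]_p) = 0.
Proof.
rewrite /enorm big1 ?sqrtr0// => i _.
by rewrite mxE expr0n.
Qed.

Lemma enorm_eq0 x : enorm x = 0 -> x = 0.
Proof.
move=> x0; have := sqr_enorm x; rewrite x0 expr0n/= => /esym/eqP.
rewrite psumr_eq0; last by move=> i _; exact: sqr_ge0.
move=> /allP h; apply/rowP => i; rewrite mxE.
by have := h i; rewrite mem_index_enum sqrf_eq0 => /(_ isT)/eqP.
Qed.

Lemma enormB x y : enorm (x - y) = enorm (y - x).
Proof. by rewrite -opprB enormN. Qed.

Lemma enorm_cauchy_schwarz x y :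
  \sum_(i < p) x ord0 i * y ord0 i <= enorm x * enorm y.
Proof.
have [x0|x0] := eqVneq (enorm x) 0.
  by rewrite x0 mul0r (enorm_eq0 x0) big1// => i _; rewrite mxE mul0r.
have [y0|y0] := eqVneq (enorm y) 0.
  by rewrite y0 mulr0 (enorm_eq0 y0) big1// => i _; rewrite mxE mulr0.
have px : 0 < enorm x by rewrite lt_def x0 enorm_ge0.
have py : 0 < enorm y by rewrite lt_def y0 enorm_ge0.
have : 0 <= \sum_(i < p) (enorm y * x ord0 i - enorm x * y ord0 i) ^+ 2.
  by apply: sumr_ge0 => i _; exact: sqr_ge0.
have -> : \sum_(i < p) (enorm y * x ord0 i - enorm x * y ord0 i) ^+ 2 =
  enorm y ^+ 2 * (\sum_(i < p) x ord0 i ^+ 2)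
  + enorm x ^+ 2 * (\sum_(i < p) y ord0 i ^+ 2)
  - 2 * (enorm x * enorm y) * \sum_(i < p) x ord0 i * y ord0 i.
  rewrite !mulr_sumr -big_split/= -sumrB; apply: eq_bigr => i _; ring.
rewrite -!sqr_enorm => h.
have {h} : 0 <= 2 * (enorm x * enorm y) *
    (enorm x * enorm y - \sum_(i < p) x ord0 i * y ord0 i).
  by apply: le_trans h _; rewrite le_eqVlt; apply/orP; left; apply/eqP; ring.
by rewrite pmulr_rge0 ?subr_ge0// !mulr_gt0.
Qed.

Lemma enormD x y : enorm (x + y) <= enorm x + enorm y.
Proof.
rewrite -(@ler_pXn2r _ 2)// ?nnegrE ?addr_ge0 ?enorm_ge0//.
rewrite sqr_enorm.
under eq_bigr => i _ do rewrite mxE sqrrD.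
rewrite !big_split/= -!sqr_enorm sqrrD lerD2r lerD2l.
by rewrite mulr2n lerD// enorm_cauchy_schwarz.
Qed.

Lemma enorm_triangle z x y : enorm (x - y) <= enorm (x - z) + enorm (z - y).
Proof. by have := enormD (x - z) (z - y); rewrite addrA subrK. Qed.

Lemma continuous_enorm : continuous (@enorm R p).
Proof.
move=> x; rewrite /enorm.
apply: (@continuous_comp _ _ _ (fun x : 'rV[R]_p => \sum_(i < p) x ord0 i ^+ 2)
  Num.sqrt); last exact: sqrt_continuous.
apply: continuous_big => [|i _ {}x]; first exact: add_continuous.
apply: (@continuous_comp _ _ _ (fun x : 'rV[R]_p => x ord0 i)
   (fun t : R => t ^+ 2)); last exact: exprn_continuous.
exact: coord_continuous.
Qed.

Lemma continuous_enormB y : continuous (fun x => enorm (x - y)).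
Proof.
move=> x; apply: (@continuous_comp _ _ _ (fun x => x - y) (@enorm R p)).
  by apply: (@cvgB _ _ _ (nbhs x)); [exact: cvg_id|exact: cvg_cst].
exact: continuous_enorm.
Qed.

End EuclideanNorm.

(** * The Hausdorff measure is a metric outer measure *)

Section HausdorffMeasure.
Context {R : realType} {p : nat} (d : R).
Hypothesis d_gt0 : 0 < d.
Implicit Types (E F : set 'rV[R]_p).
Local Open Scope ereal_scope.

Lemma ediam_ge0 E : 0 <= ediam E.
Proof. by apply: ereal_sup_ubound; left. Qed.

Lemma enorm_le_ediam E x y : E x -> E y -> (enorm (x - y))%:E <= ediam E.
Proof. by move=> Ex Ey; apply: ereal_sup_ubound; right; exists (x, y). Qed.

Lemma ediam_set0 : ediam (set0 : set 'rV[R]_p) = 0.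
Proof.
apply/eqP; rewrite eq_le ediam_ge0 andbT; apply: ge_ereal_sup => ? [->//|].
by case=> -[x y] [].
Qed.

Lemma hausdorff_cover_ge0 (U : (set 'rV[R]_p)^nat) :
  0 <= \sum_(0 <= i <oo) (ediam (U i)) `^ d.
Proof. by apply: nneseries_ge0 => n _ _; exact: poweR_ge0. Qed.

Lemma hausdorff_premeasure_ge0 (delta : R) E : 0 <= hausdorff_premeasure d delta E.
Proof. by apply: le_ereal_inf_tmp => _ [U _ <-]; exact: hausdorff_cover_ge0. Qed.

Lemma hausdorff_premeasure_le (delta : R) E F : E `<=` F ->
  hausdorff_premeasure d delta E <= hausdorff_premeasure d delta F.
Proof.
move=> EF; apply: le_ereal_inf => _ [U [FU dU] <-]; exists U => //.
by split=> //; exact: subset_trans FU.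
Qed.

Lemma hausdorff_premeasure_antitone (delta eta : R) E : (delta <= eta)%R ->
  hausdorff_premeasure d eta E <= hausdorff_premeasure d delta E.
Proof.
move=> de; apply: le_ereal_inf => _ [U [EU dU] <-]; exists U => //.
by split=> // i; rewrite (le_trans (dU i))// lee_fin.
Qed.

Lemma hausdorff_premeasure_le_unnormalized (delta : R) E : (0 < delta)%R ->
  hausdorff_premeasure d delta E <= hausdorff_unnormalized d E.
Proof. by move=> delta0; apply: ereal_sup_ubound; exists delta. Qed.

Lemma hausdorff_unnormalized_ge0 E : 0 <= hausdorff_unnormalized d E.
Proof.
by apply: le_trans (hausdorff_premeasure_le_unnormalized _ (@ltr01 R));
  exact: hausdorff_premeasure_ge0.
Qed.

Lemma hausdorff_unnormalized_le E F : E `<=` F ->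
  hausdorff_unnormalized d E <= hausdorff_unnormalized d F.
Proof.
move=> EF; apply: ge_ereal_sup => _ [t t0 <-].
by rewrite (le_trans (hausdorff_premeasure_le t EF))//
  hausdorff_premeasure_le_unnormalized.
Qed.

Lemma hausdorff_unnormalized_set0 : hausdorff_unnormalized d (set0 : set 'rV[R]_p) = 0.
Proof.
apply/eqP; rewrite eq_le hausdorff_unnormalized_ge0 andbT.
apply: ge_ereal_sup => _ [t t0 <-]; apply: ereal_inf_lbound.
exists (fun=> set0).
  by split=> [//|i]; rewrite ediam_set0 lee_fin ltW.
by apply: eseries0 => i _ _; rewrite ediam_set0 poweR0r// gt_eqF.
Qed.

Definition interleave {T : Type} (U V : nat -> T) (n : nat) : T :=
  if odd n then V n./2 else U n./2.

Lemma nneseries_interleave (u v : (\bar R)^nat) :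
  (forall n, 0 <= u n) -> (forall n, 0 <= v n) ->
  \sum_(0 <= n <oo) interleave u v n <=
  \sum_(0 <= n <oo) u n + \sum_(0 <= n <oo) v n.
Proof.
move=> u0 v0.
have uv0 n : 0 <= interleave u v n by rewrite /interleave; case: ifP.
apply: lime_le; first by apply: is_cvg_nneseries => n _ _.
apply: nearW => n.
apply: (@le_trans _ _ (\sum_(0 <= i < n) u i + \sum_(0 <= i < n) v i));
  last by apply: leeD; apply: nneseries_lim_ge.
have double m : \sum_(0 <= i < m.*2) interleave u v i =
    \sum_(0 <= i < m) u i + \sum_(0 <= i < m) v i.
  elim: m => [|m IH]; first by rewrite !big_nil adde0.
  rewrite doubleS !big_nat_recr//= IH /interleave/= odd_double/= uphalf_double.
  by rewrite doubleK addeACA addeA.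
rewrite -double; apply: lee_sum_nneg_natr => //.
by rewrite -addnn leq_addr.
Qed.

(** Two covers are merged into one by alternating their terms. *)
Lemma hausdorff_premeasureU (delta : R) E F :
  hausdorff_premeasure d delta (E `|` F) <=
  hausdorff_premeasure d delta E + hausdorff_premeasure d delta F.
Proof.
have key (U V : (set 'rV[R]_p)^nat) :
    (E `<=` \bigcup_i U i /\ forall i, ediam (U i) <= delta%:E) ->
    (F `<=` \bigcup_i V i /\ forall i, ediam (V i) <= delta%:E) ->
  hausdorff_premeasure d delta (E `|` F) <=
  \sum_(0 <= i <oo) (ediam (U i)) `^ d + \sum_(0 <= i <oo) (ediam (V i)) `^ d.
  move=> [EU dU] [FV dV]; apply: le_trans (nneseries_interleave _ _); last 2 first.
  - by move=> n; exact: poweR_ge0.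
  - by move=> n; exact: poweR_ge0.
  apply: ereal_inf_lbound; exists (interleave U V).
    split=> [x [/EU[i _ Ui]|/FV[i _ Vi]]|i].
    - by exists i.*2 => //; rewrite /interleave odd_double doubleK.
    - by exists i.*2.+1 => //; rewrite /interleave/= odd_double/= uphalf_double.
    - by rewrite /interleave; case: ifP.
  by apply: eq_eseriesr => i _; rewrite /interleave; case: ifP.
have [->|Eoo] := eqVneq (hausdorff_premeasure d delta E) +oo.
  by rewrite addye ?leey// gt_eqF// (lt_le_trans _ (hausdorff_premeasure_ge0 _ _)).
have [->|Foo] := eqVneq (hausdorff_premeasure d delta F) +oo.
  by rewrite addey ?leey// gt_eqF// (lt_le_trans _ (hausdorff_premeasure_ge0 _ _)).
have Efin : hausdorff_premeasure d delta E \is a fin_num.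
  by rewrite ge0_fin_numE ?hausdorff_premeasure_ge0// lt_neqAle Eoo leey.
have Ffin : hausdorff_premeasure d delta F \is a fin_num.
  by rewrite ge0_fin_numE ?hausdorff_premeasure_ge0// lt_neqAle Foo leey.
apply/lee_addgt0Pr => e e0.
have e20 : (0 < e / 2)%R by rewrite divr_gt0.
have [_ [U hU <-] Ue] := lb_ereal_inf_adherent e20 Efin.
have [_ [V hV <-] Ve] := lb_ereal_inf_adherent e20 Ffin.
apply: le_trans (key _ _ hU hV) _.
rewrite [e in (_ + e%:E)]splitr EFinD addeACA.
by apply: leeD; exact: ltW.
Qed.

Lemma hausdorff_unnormalizedU E F :
  hausdorff_unnormalized d (E `|` F) <=
  hausdorff_unnormalized d E + hausdorff_unnormalized d F.
Proof.
apply: ge_ereal_sup => _ [t t0 <-].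
apply: le_trans (hausdorff_premeasureU _ _ _) _.
by apply: leeD; exact: hausdorff_premeasure_le_unnormalized.
Qed.

(** A set of diameter less than [rho] cannot meet both [E] and [F], so a cover of
    the union by such sets splits into a cover of [E] and a cover of [F]; the
    sets that go to the other side are replaced by the empty set, whose diameter
    contributes 0. *)
Lemma hausdorff_premeasure_separated (delta rho : R) E F : (delta < rho)%R ->
  (forall x y, E x -> F y -> (rho <= enorm (x - y))%R) ->
  hausdorff_premeasure d delta E + hausdorff_premeasure d delta F <=
  hausdorff_premeasure d delta (E `|` F).
Proof.
move=> dr sepEF; apply: le_ereal_inf_tmp => _ [U [EFU dU] <-].
pose UE n := if `[< U n `&` E !=set0 >] then U n else set0.
pose UF n := if `[< U n `&` E !=set0 >] then set0 else U n.
have z : (0 : \bar R) `^ d = 0 by rewrite poweR0r// gt_eqF.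
have -> : \sum_(0 <= i <oo) (ediam (U i)) `^ d =
    \sum_(0 <= i <oo) (ediam (UE i)) `^ d + \sum_(0 <= i <oo) (ediam (UF i)) `^ d.
  rewrite -nneseriesD; [|by move=> n _ _; exact: poweR_ge0..].
  apply: eq_eseriesr => i _; rewrite /UE /UF; case: ifP => _.
    by rewrite ediam_set0 z adde0.
  by rewrite ediam_set0 z add0e.
apply: leeD; apply: ereal_inf_lbound; eexists; try reflexivity; split.
- move=> x Ex; have [|i _ Uix] := EFU x; first by left.
  by exists i => //; rewrite /UE; case: asboolP => // -[]; exists x.
- move=> i; rewrite /UE; case: ifP => // _; rewrite ediam_set0.
  exact: le_trans (ediam_ge0 _) (dU i).
- move=> y Fy; have [|i _ Uiy] := EFU y; first by right.
  exists i => //; rewrite /UF; case: asboolP => // -[x [Uix Ex]].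
  have := le_trans (enorm_le_ediam Uix Uiy) (dU i).
  by rewrite lee_fin => /(le_trans (sepEF _ _ Ex Fy)); rewrite leNgt dr.
- move=> i; rewrite /UF; case: ifP => // _; rewrite ediam_set0.
  exact: le_trans (ediam_ge0 _) (dU i).
Qed.

(** The two suprema over mesh sizes are taken independently, so the mesh sizes
    are first lowered to a common value below the separation. *)
Lemma hausdorff_unnormalized_separated (rho : R) E F : (0 < rho)%R ->
  (forall x y, E x -> F y -> (rho <= enorm (x - y))%R) ->
  hausdorff_unnormalized d E + hausdorff_unnormalized d F <=
  hausdorff_unnormalized d (E `|` F).
Proof.
move=> rho0 sepEF.
have key (s t : R) : (0 < s)%R -> (0 < t)%R ->
    hausdorff_premeasure d s E + hausdorff_premeasure d t F <=
    hausdorff_unnormalized d (E `|` F).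
  move=> s0 t0; pose u : R := Num.min (Num.min s t) (rho / 2)%R.
  have u0 : (0 < u)%R by rewrite !lt_min s0 t0 divr_gt0.
  have us : (u <= s)%R by rewrite !ge_min lexx.
  have ut : (u <= t)%R by rewrite !ge_min lexx orbT.
  have ur : (u < rho)%R.
    by rewrite (@le_lt_trans _ _ (rho / 2)%R)// ?ge_min ?lexx ?orbT// ltr_pdivrMr// ltr_pMr// ltr1n.
  apply: le_trans (hausdorff_premeasure_le_unnormalized _ u0).
  apply: le_trans (hausdorff_premeasure_separated ur sepEF).
  by apply: leeD; exact: hausdorff_premeasure_antitone.
have [->|Hoo] := eqVneq (hausdorff_unnormalized d (E `|` F)) +oo.
  by rewrite leey.
have Hfin : hausdorff_unnormalized d (E `|` F) \is a fin_num.
  by rewrite ge0_fin_numE ?hausdorff_unnormalized_ge0// lt_neqAle Hoo leey.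
have pfin G t : G `<=` E `|` F -> (0 < t)%R ->
    hausdorff_premeasure d t G \is a fin_num.
  move=> GEF t0; rewrite ge0_fin_numE ?hausdorff_premeasure_ge0//.
  apply: le_lt_trans (hausdorff_premeasure_le_unnormalized _ t0) _.
  apply: le_lt_trans (hausdorff_unnormalized_le GEF) _.
  by rewrite lt_neqAle Hoo leey.
have Hfin2 G : G `<=` E `|` F -> hausdorff_unnormalized d G \is a fin_num.
  move=> GEF; rewrite ge0_fin_numE ?hausdorff_unnormalized_ge0//.
  apply: le_lt_trans (hausdorff_unnormalized_le GEF) _.
  by rewrite lt_neqAle Hoo leey.
have EEF : E `<=` E `|` F by left.
have FEF : F `<=` E `|` F by right.
rewrite -leeBrDr ?Hfin2//.
apply: ge_ereal_sup => _ [s s0 <-].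
rewrite leeBrDr ?Hfin2// addeC -leeBrDr ?pfin//.
apply: ge_ereal_sup => _ [t t0 <-].
by rewrite leeBrDr ?pfin// addeC; exact: key.
Qed.

End HausdorffMeasure.

(** * Separated points in regular sets *)

Section RegularSets.
Context {R : realType} {p : nat} (d : R).
Hypothesis d_gt0 : 0 < d.
Implicit Types (A E F : set 'rV[R]_p).

Lemma hausdorff_cst_ge0 : 0 <= hausdorff_cst p d.
Proof.
rewrite /hausdorff_cst; case: ifP => _ //.
by rewrite invr_ge0 fine_ge0// hausdorff_unnormalized_ge0.
Qed.

Lemma hausdorff_le E F : E `<=` F -> (hausdorff d E <= hausdorff d F)%E.
Proof.
move=> EF; rewrite /hausdorff lee_wpmul2l ?lee_fin ?hausdorff_cst_ge0//.
exact: hausdorff_unnormalized_le.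
Qed.

Lemma hausdorff_set0 : hausdorff d (set0 : set 'rV[R]_p) = 0%E.
Proof. by rewrite /hausdorff hausdorff_unnormalized_set0 ?mule0. Qed.

Lemma hausdorffU E F : (hausdorff d (E `|` F) <= hausdorff d E + hausdorff d F)%E.
Proof.
rewrite /hausdorff -ge0_muleDr ?hausdorff_unnormalized_ge0//.
by rewrite lee_wpmul2l ?lee_fin ?hausdorff_cst_ge0// hausdorff_unnormalizedU.
Qed.

Lemma hausdorff_separated (rho : R) E F : 0 < rho ->
  (forall x y, E x -> F y -> rho <= enorm (x - y)) ->
  (hausdorff d E + hausdorff d F <= hausdorff d (E `|` F))%E.
Proof.
move=> rho0 sepEF; rewrite /hausdorff -ge0_muleDr ?hausdorff_unnormalized_ge0//.
rewrite lee_wpmul2l ?lee_fin ?hausdorff_cst_ge0//.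
exact: (@hausdorff_unnormalized_separated _ _ _ d_gt0 rho).
Qed.

(** The bounds of a regular set on an interval of radii with real endpoint: the
    diameter that bounds the radii in [regular_set] is an extended real. *)
Definition regular_upto A (c C r0 : R) := forall (y : 'rV[R]_p) (r : R),
  A y -> 0 < r -> r <= r0 ->
  ((c * r `^ d)%:E <= hausdorff d (eball y r `&` A) <= (C * r `^ d)%:E)%E.

Lemma regular_set_upto A : regular_set d A ->
  exists c C r0 : R, [/\ 0 < c, 0 < C, 0 < r0 & regular_upto A c C r0].
Proof.
move=> [_ _ diamA [c [C [c0 C0 reg]]]].
have [r0 r00 r0A] : exists2 r0 : R, 0 < r0 & (r0%:E < ediam A)%E.
  case: (ediam A) diamA => [t|_|//].
  - by rewrite lte_fin => t0; exists (t / 2);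
      rewrite ?lte_fin ?divr_gt0 ?ltr_pdivrMr ?ltr_pMr ?ltr1n.
  - by exists 1; rewrite ?ltr01 ?ltry.
exists c, C, r0; split=> // y r Ay r_gt0 rr0; apply: reg => //.
by apply: le_lt_trans r0A; rewrite lee_fin.
Qed.

Definition separated (delta : R) (ys : seq 'rV[R]_p) :=
  pairwise (fun x y => delta <= enorm (x - y)) ys.

Definition balls_in A (s : R) (ys : seq 'rV[R]_p) : set 'rV[R]_p :=
  [set x | A x /\ exists2 y, y \in ys & eball y s x].

Lemma balls_in_cons A s y ys :
  balls_in A s (y :: ys) = (eball y s `&` A) `|` balls_in A s ys.
Proof.
apply/seteqP; split=> x.
- move=> [Ax [z]]; rewrite inE => /predU1P[-> ?|zys zx]; first by left.
  by right; split=> //; exists z.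
- case=> [[yx Ax]|[Ax [z zys zx]]]; split=> //.
    by exists y => //; rewrite mem_head.
  by exists z => //; rewrite inE zys orbT.
Qed.

Section Counting.
Variables (A : set 'rV[R]_p) (c C r0 : R).
Hypotheses (c_gt0 : 0 < c) (C_gt0 : 0 < C).
Hypothesis A_reg : regular_upto A c C r0.

(** Balls of radius [delta / 4] around [delta]-separated points are at distance at
    least [delta / 2] from each other; disjointness alone would not make an outer
    measure superadditive without knowing that balls are measurable. *)
Lemma separated_packing (delta : R) ys : 0 < delta -> delta / 4 <= r0 ->
  separated delta ys -> (forall y, y \in ys -> A y) ->
  ((size ys)%:R%:E * (c * (delta / 4) `^ d)%:E <=
   hausdorff d (balls_in A (delta / 4) ys))%E.
Proof.
move=> delta0 deltar0; elim: ys => [_ _|y ys IH] /=.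
  rewrite mul0e; apply: le_trans (hausdorff_le (sub0set _)).
  by rewrite hausdorff_set0.
move=> /andP[/allP ysep sep] Ays; rewrite balls_in_cons.
have sepU : forall x z, (eball y (delta / 4) `&` A) x ->
    balls_in A (delta / 4) ys z -> delta / 2 <= enorm (x - z).
  move=> x z [yx _] [_ [w wys wz]]; rewrite /eball/= in yx wz.
  have /= := ysep _ wys; have := enorm_triangle x y w.
  by have := enorm_triangle z x w; rewrite (enormB y x); lra.
apply: le_trans (hausdorff_separated _ sepU); last by rewrite divr_gt0.
rewrite -nat1r EFinD ge0_muleDl ?lee_fin// mul1e; apply: leeD.
  have Ay : A y by apply: Ays; rewrite mem_head.
  have d40 : 0 < delta / 4 by rewrite divr_gt0.
  by have /andP[] := A_reg Ay d40 deltar0.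
by apply: IH => // z zys; apply: Ays; rewrite inE zys orbT.
Qed.

Lemma covering_bound (delta : R) ys : 0 < delta -> delta <= r0 ->
  (forall y, y \in ys -> A y) ->
  (hausdorff d (balls_in A delta ys) <= (size ys)%:R%:E * (C * delta `^ d)%:E)%E.
Proof.
move=> delta0 deltar0; elim: ys => [_|y ys IH Ays] /=.
  by rewrite mul0e (_ : balls_in _ _ _ = set0) ?hausdorff_set0//;
    apply/seteqP; split=> // x [_ []].
rewrite balls_in_cons (le_trans (hausdorffU _ _))//.
rewrite -nat1r EFinD ge0_muleDl ?lee_fin// mul1e; apply: leeD.
  have Ay : A y by apply: Ays; rewrite mem_head.
  by have /andP[] := A_reg Ay delta0 deltar0.
by apply: IH => // z zys; apply: Ays; rewrite inE zys orbT.
Qed.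

(** The small balls around the points within [s] of [x] all lie in the ball of
    radius [2 s] at [x], and the packing bound applies to them. *)
Lemma separated_count (delta s : R) x ys : 0 < delta -> delta <= s ->
  2 * s <= r0 -> separated delta ys -> (forall y, y \in ys -> A y) -> A x ->
  (count (fun y => enorm (x - y) < s) ys)%:R * (c * (delta / 4) `^ d) <=
  C * (2 * s) `^ d.
Proof.
move=> delta0 deltas sr0 sep Ays Ax.
rewrite -lee_fin EFinM -size_filter.
have s0 : 0 < s by exact: lt_le_trans deltas.
have dr0 : delta / 4 <= r0 by lra.
apply: le_trans (separated_packing delta0 dr0 _ _) _.
- by rewrite /separated pairwise_filter.
- by move=> y; rewrite mem_filter => /andP[_]; exact: Ays.
have s20 : 0 < 2 * s by rewrite mulr_gt0.
have /andP[_] := A_reg Ax s20 sr0; apply: le_trans; apply: hausdorff_le.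
move=> z [Az [y]]; rewrite mem_filter => /andP[xy _] yz; split=> //.
rewrite /eball/= in yz *.
by have := enorm_triangle y z x; move: xy; rewrite (enormB x); lra.
Qed.

(** The packing bound limits the number of separated points, so a separated set
    with the most points exists; none can be added to it, hence it is a net. *)
Lemma maximal_separated (delta r : R) y0 : A y0 -> 0 < delta -> delta <= r ->
  2 * r <= r0 -> exists ys : seq 'rV[R]_p,
    [/\ separated delta ys, forall y, y \in ys -> A y /\ enorm (y - y0) < r &
     forall x, A x -> enorm (x - y0) < r ->
       exists2 y, y \in ys & enorm (x - y) < delta].
Proof.
move=> Ay0 delta0 deltar rr0.
pose good ys := separated delta ys /\ forall y, y \in ys -> A y /\ enorm (y - y0) < r.
pose P n := `[< exists2 ys, good ys & size ys = n >].
have exP : exists n, P n by exists 0%N; apply/asboolP; exists [::].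
pose b := C * (2 * r) `^ d / (c * (delta / 4) `^ d).
have cd0 : 0 < c * (delta / 4) `^ d by rewrite mulr_gt0// powR_gt0// divr_gt0.
have ubP n : P n -> (n <= Num.truncn b)%N.
  move=> /asboolP[ys [sep ysA] <-]; rewrite truncn_ge_nat; last first.
    by rewrite divr_ge0 ?mulr_ge0 ?powR_ge0 ?ltW.
  rewrite ler_pdivlMr//.
  have -> : size ys = count (fun y => enorm (y0 - y) < r) ys.
    apply/esym/eqP; rewrite -all_count; apply/allP => y /ysA[_].
    by rewrite enormB.
  by apply: separated_count => // y /ysA[].
case: (ex_maxnP exP ubP) => n /asboolP[ys [sep ysA] sz] maxn.
exists ys; split=> // x Ax xr; apply/not_exists2P => far.
have : P n.+1.
  apply/asboolP; exists (x :: ys); last by rewrite /= sz.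
  split; last first.
    by move=> y; rewrite inE => /predU1P[->|/ysA].
  apply/andP; split; last exact: sep.
  apply/allP => y yys.
  by rewrite leNgt; apply/negP => xy; have [] := far y.
by move=> /maxn; rewrite ltnn.
Qed.

(** A finite substitute for the normalized Hausdorff measure on the ball of radius
    [r] at [y0].  The packing bound limits the number of points within [s] of [x]
    from above; the net property, through the covering bound, limits the total
    number of points from below.  The powers of [delta] cancel in the ratio. *)
Lemma separated_net (delta r : R) y0 : A y0 -> 0 < delta -> delta <= r ->
  2 * r <= r0 -> exists ys : seq 'rV[R]_p,
    [/\ (0 < size ys)%N, forall y, y \in ys -> A y /\ enorm (y - y0) < r &
     forall x s, A x -> delta <= s -> 2 * s <= r0 ->
       (count (fun y => enorm (x - y) < s) ys)%:R <=
       (C / c) ^+ 2 * 8 `^ d * (s / r) `^ d * (size ys)%:R].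
Proof.
move=> Ay0 delta0 deltar rr0.
have [ys [sep ysA net]] := maximal_separated Ay0 delta0 deltar rr0.
have r_gt0 : 0 < r by exact: lt_le_trans deltar.
exists ys; split=> //.
  have [|y] := net _ Ay0; first by rewrite subrr enorm0.
  by case: ys {sep ysA net}.
move=> x s Ax deltas sr0.
have h1 := separated_count delta0 deltas sr0 sep (fun y yys => (ysA y yys).1) Ax.
have h2 : c * r `^ d <= (size ys)%:R * (C * delta `^ d).
  rewrite -lee_fin EFinM; have rr0' : r <= r0 by lra.
  have /andP[+ _] := A_reg Ay0 r_gt0 rr0'; move=> /le_trans; apply.
  apply: le_trans (covering_bound delta0 _ _); [|lra|by move=> y /ysA[]].
  apply: hausdorff_le => z [/= zy0 Az]; split=> //.
  have [y yys yz] := net z Az zy0; exists y => //=.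
set N := (count _ _)%:R in h1 *.
have s_gt0 : 0 < s by exact: lt_le_trans deltas.
have dd : 0 < delta `^ d by exact: powR_gt0.
have rd : 0 < r `^ d by exact: powR_gt0.
have sd : 0 < s `^ d by exact: powR_gt0.
have e2 : 0 < (2 : R) `^ d by exact: powR_gt0.
have e4 : 0 < (4 : R) `^ d by exact: powR_gt0.
have E8 : (8 : R) `^ d = 2 `^ d * 4 `^ d by rewrite -powRM//; congr powR; lra.
rewrite E8.
have Ediv (a b : R) : 0 <= a -> 0 < b -> (a / b) `^ d = a `^ d / b `^ d.
  move=> a0 /ltW b0; rewrite powRM ?invr_ge0//.
  by rewrite -powR_inv1// -powRrM mulN1r powRN.
have [s_ge0 delta_ge0] := (ltW s_gt0, ltW delta0).
move: h1; rewrite !Ediv// powRM// => h1.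
have -> : (C / c) ^+ 2 * (2 `^ d * 4 `^ d) * (s `^ d / r `^ d) * (size ys)%:R =
  (C * (2 `^ d * s `^ d)) * ((size ys)%:R * (C * delta `^ d)) /
   ((c * (delta `^ d / 4 `^ d)) * (c * r `^ d)).
  by field; rewrite !gt_eqF.
have P0 : 0 < c * (delta `^ d / 4 `^ d) by rewrite !mulr_gt0 ?invr_gt0.
have Q0 : 0 < c * r `^ d by rewrite mulr_gt0.
rewrite ler_pdivlMr ?mulr_gt0// (mulrA N).
apply: ler_pM h1 h2; last exact: ltW Q0.
by apply: mulr_ge0; [exact: ler0n|exact: ltW P0].
Qed.

End Counting.
End RegularSets.

(** * Averages of the kernel over separated points *)

Section KernelAverages.
Context {R : realType} {p : nat}.

(** For a decreasing continuous [f] on the positive reals and [delta > 0] this is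
    a bounded continuous kernel on [[0, oo[], the value at 0 included. *)
Definition truncated (f : R -> R) (delta t : R) : R := f (Num.max t delta).

(** All that the growth condition on [f] is used for: the factor is
    [lam = 2^(d - eps)], and [lam < 2^d] is what makes the dyadic sums below
    geometric. *)
Lemma riesz_like_doubling (d : R) (f : R -> R) : riesz_like d f ->
  exists lam t1 : R, [/\ 0 < lam, lam < 2 `^ d, 0 < t1 &
    forall s, 0 < s -> s <= t1 -> f (s / 2) <= lam * f s].
Proof.
move=> [f0 _ _ [eps [t1 [eps0 epsd t10 mono]]]].
exists (2 `^ (d - eps)), t1; split=> //.
  rewrite powRB ?pnatr_eq0 ?implybT// ltr_pdivrMr ?powR_gt0//.
  rewrite ltr_pMr ?powR_gt0//.
  have := gt0_ltr_powR eps0 (_ : 1 \in Num.nneg) (_ : 2 \in Num.nneg).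
  by rewrite powR1 !nnegrE; apply=> //; rewrite ltr1n.
move=> s s0 st1; have s20 : 0 < s / 2 by rewrite divr_gt0.
have s2s : s / 2 <= s by rewrite ler_pdivrMr// ler_peMr ?ltW// ltr1n.
have := mono (s / 2) s; rewrite !in_itv/= !(gt_eqF s0, gt_eqF s20).
rewrite (ltW s0) (ltW s20) st1 (le_trans s2s st1) => /(_ isT isT s2s).
have -> : s `^ (d - eps) = (s / 2) `^ (d - eps) * 2 `^ (d - eps).
  by rewrite -powRM ?(ltW s20)// divfK.
by rewrite -mulrA ler_pM2l// powR_gt0.
Qed.

Section Averages.
Variables (d : R) (f : R -> R) (lam t1 : R).
Hypotheses (f_gt0 : forall t, 0 < t -> 0 < f t).
Hypotheses (f_le : forall s t, 0 < s -> s <= t -> f t <= f s).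
Hypotheses (lam_gt0 : 0 < lam) (lam_lt : lam < 2 `^ d).
Hypotheses (f_half : forall s, 0 < s -> s <= t1 -> f (s / 2) <= lam * f s).

(** The solution [B] of [B = B (lam / 2^d) + K lam], the equation that the
    induction on scales requires. *)
Let dyadic_cst (K : R) := K * lam / (1 - lam / 2 `^ d).

Let ratio_lt1 : lam / 2 `^ d < 1.
Proof. by rewrite ltr_pdivrMr ?mul1r// powR_gt0. Qed.

(** Induction on scales.  The points at distance between [s / 2] and [s] are at
    most [K (s / r)^d n] in number, each contributing at most
    [f (s / 2) <= lam f s]; for the closer points the induction hypothesis at
    [s / 2] gives the bound at [s] times [lam / 2^d].  The induction stops at the
    scale [delta], below which the kernel is constant. *)
Lemma dyadic_kernel_sum (ys : seq 'rV[R]_p) x (delta r r0 K : R) :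
  0 < delta -> 0 < r -> 0 <= K ->
  (forall s, delta <= s -> 2 * s <= r0 ->
    (count (fun y => enorm (x - y) < s) ys)%:R <=
       K * (s / r) `^ d * (size ys)%:R) ->
  forall (m : nat) (s : R), delta <= s -> s < 2 ^+ m * delta -> s <= t1 ->
    2 * s <= r0 ->
  \sum_(y <- ys | enorm (x - y) < s) truncated f delta (enorm (x - y)) <=
    dyadic_cst K * (s / r) `^ d * f s * (size ys)%:R.
Proof.
move=> delta0 r_gt0 K0 cnt; set n := (size ys)%:R.
have n0 : 0 <= n by exact: ler0n.
have B0 : 0 <= dyadic_cst K.
  by rewrite divr_ge0 ?subr_ge0 ?(ltW ratio_lt1)// mulr_ge0// ltW.
elim=> [s ds|m IH s ds sm st1 sr0].
  by rewrite expr0 mul1r => /(le_lt_trans ds); rewrite ltxx.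
have s0 : 0 < s by exact: lt_le_trans ds.
have s20 : 0 < s / 2 by rewrite divr_gt0.
have fs0 : 0 < f s by exact: f_gt0.
have tr u : s / 2 <= u -> truncated f delta u <= lam * f s.
  move=> su; apply: le_trans (f_half s0 st1); apply: f_le => //.
  by rewrite le_max su.
have cst : dyadic_cst K = dyadic_cst K * (lam / 2 `^ d) + K * lam.
  rewrite /dyadic_cst; field.
  by rewrite (gt_eqF (powR_gt0 _ _))//= subr_eq0 gt_eqF.
have count_sum (a : R) (P : pred 'rV[R]_p) : 0 <= a ->
    (forall y, P y -> enorm (x - y) < s) ->
    \sum_(y <- ys | P y) a <= (count (fun y => enorm (x - y) < s) ys)%:R * a.
  move=> a0 Ps; rewrite big_const_seq iter_addr_0 -[leLHS]mulr_natl.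
  by apply: ler_wpM2r => //; rewrite ler_nat; exact: sub_count.
have lf0 : 0 <= lam * f s by rewrite mulr_ge0 ?ltW.
have top : (count (fun y => enorm (x - y) < s) ys)%:R * (lam * f s) <=
    K * lam * (s / r) `^ d * f s * n.
  apply: le_trans (ler_wpM2r lf0 (cnt s ds sr0)) _.
  by rewrite -/n le_eqVlt; apply/orP; left; apply/eqP; ring.
(* At the last scale all points are counted with the largest kernel value. *)
have [ds2|ds2] := leP delta (s / 2); last first.
  have h : \sum_(y <- ys | enorm (x - y) < s) truncated f delta (enorm (x - y))
      <= \sum_(y <- ys | enorm (x - y) < s) (lam * f s).
    apply: ler_sum => y _; apply: le_trans (f_half s0 st1).
    by apply: f_le => //; rewrite le_max (ltW ds2) orbT.
  apply: le_trans h _; apply: le_trans (count_sum _ _ lf0 _) _ => //.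
  apply: le_trans top _; apply: ler_wpM2r => //.
  apply: ler_wpM2r; first exact: ltW fs0.
  apply: ler_wpM2r; first exact: powR_ge0.
  rewrite [leRHS]cst lerDr mulr_ge0// divr_ge0 ?powR_ge0// ltW//.
rewrite (bigID (fun y => enorm (x - y) < s / 2))/=.
have -> : dyadic_cst K * (s / r) `^ d * f s * n =
   dyadic_cst K * (lam / 2 `^ d) * (s / r) `^ d * f s * n +
   K * lam * (s / r) `^ d * f s * n by rewrite [in LHS]cst; ring.
apply: lerD.
  rewrite (eq_bigl (fun y => enorm (x - y) < s / 2)); last first.
    move=> y; apply/andP/idP => [[]//|h]; split=> //.
    by apply: lt_trans h _; rewrite ltr_pdivrMr// ltr_pMr// ltr1n.
  apply: le_trans (IH _ ds2 _ _ _) _.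
  - by rewrite ltr_pdivrMr// mulrAC -exprSr.
  - lra.
  - lra.
  have -> : (s / 2 / r) `^ d = (s / r) `^ d / 2 `^ d.
    rewrite (_ : s / 2 / r = s / r * 2^-1); last by rewrite mulrAC.
    rewrite powRM ?invr_ge0//; last by rewrite divr_ge0 ?ltW.
    by rewrite -[2^-1]powR_inv1// -powRrM mulN1r powRN.
  have X0 : 0 <= dyadic_cst K * ((s / r) `^ d / 2 `^ d) * n.
    apply: mulr_ge0 => //; apply: mulr_ge0 => //.
    by rewrite divr_ge0 ?powR_ge0.
  rewrite mulrAC; apply: le_trans (ler_wpM2l X0 (f_half s0 st1)) _.
  by rewrite le_eqVlt; apply/orP; left; apply/eqP; ring.
apply: le_trans top.
have h : \sum_(y <- ys | (enorm (x - y) < s) && ~~ (enorm (x - y) < s / 2))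
    truncated f delta (enorm (x - y))
  <= \sum_(y <- ys | (enorm (x - y) < s) && ~~ (enorm (x - y) < s / 2)) (lam * f s).
  by apply: ler_sum => y /andP[_]; rewrite -leNgt; exact: tr.
by apply: le_trans h _; apply: count_sum => // y /andP[].
Qed.

End Averages.

(** If [x] is at distance less than [2 r] from [y0], the dyadic sum is used up to
    [T = max |x - y0| r], where [(T / r)^d <= 2^d], and the remaining points see
    a kernel value at most [f T].  If [x] is farther, all points are at distance
    at least [|x - y0| / 2] from [x] and one halving step suffices. *)
Lemma kernel_average_bound (d : R) (A : set 'rV[R]_p) (f : R -> R) :
  0 < d -> regular_set d A -> riesz_like d f ->
  exists C0 R0 : R, [/\ 1 <= C0, 0 < R0 &
    forall (y0 : 'rV[R]_p) (delta r : R), A y0 -> 0 < delta -> delta <= r ->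
      r <= R0 -> exists ys : seq 'rV[R]_p,
    [/\ (0 < size ys)%N, forall y, y \in ys -> A y /\ enorm (y - y0) < r &
     forall x, A x -> enorm (x - y0) <= R0 ->
       \sum_(y <- ys) truncated f delta (enorm (x - y)) <=
       C0 * f (Num.max (enorm (x - y0)) r) * (size ys)%:R]].
Proof.
move=> d0 regA rieszf; have [f0 _ f_dec _] := rieszf.
have f_le s t : 0 < s -> s <= t -> f t <= f s.
  by move=> s0; rewrite le_eqVlt => /predU1P[->//|st]; exact/ltW/f_dec.
have [lam [t1 [lam0 lam_lt t10 f_half]]] := riesz_like_doubling rieszf.
have [c [C [r0 [c0 C0 r00 A_reg]]]] := regular_set_upto regA.
pose K := (C / c) ^+ 2 * 8 `^ d.
have K0 : 0 <= K by rewrite mulr_ge0 ?powR_ge0 ?sqr_ge0.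
pose B := K * lam / (1 - lam / 2 `^ d).
have e2 : 0 < (2 : R) `^ d by exact: powR_gt0.
have B0 : 0 <= B.
  apply: divr_ge0; first by rewrite mulr_ge0// ltW.
  by rewrite subr_ge0 ler_pdivrMr// mul1r ltW.
pose R0 := Num.min t1 (r0 / 2).
have R0t : R0 <= t1 by rewrite ge_min lexx.
have R0r : 2 * R0 <= r0 by rewrite mulrC -ler_pdivlMr// ge_min lexx orbT.
exists (B * 2 `^ d + lam + 1), R0; split.
- by rewrite lerDr addr_ge0 ?(ltW lam0)// mulr_ge0// ltW.
- by rewrite lt_min t10 divr_gt0.
move=> y0 delta r Ay0 delta0 dr rR0.
have r_gt0 : 0 < r by exact: lt_le_trans dr.
have rr0 : 2 * r <= r0 by apply: le_trans R0r; rewrite ler_pM2l.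
have [ys [ys0 ysA cnt]] := separated_net d0 c0 C0 A_reg Ay0 delta0 dr rr0.
exists ys; split=> // x Ax xR0.
set t0 := enorm (x - y0); set T := Num.max t0 r.
have rT : r <= T by rewrite le_max lexx orbT.
have tT : t0 <= T by rewrite le_max lexx.
have T0 : 0 < T by exact: lt_le_trans rT.
have TR0 : T <= R0 by rewrite ge_max xR0.
have fT0 : 0 < f T by exact: f0.
set n := (size ys)%:R.
have n0 : 0 <= n by exact: ler0n.
have sum_cst (a : R) : \sum_(y <- ys) a = a * n.
  by rewrite big_const_seq count_predT iter_addr_0 -mulr_natr.
(* [2 r] separates the points [x] inside the net from those far from it. *)
have [t0r|t0r] := ltP t0 (2 * r).
  have T2r : T <= 2 * r by rewrite ge_max (ltW t0r)/=; lra.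
  rewrite (bigID (fun y => enorm (x - y) < T))/=.
  have [m Tm] : exists m, T < 2 ^+ m * delta.
    exists (Num.truncn (T / delta)).+1; rewrite -ltr_pdivrMr//.
    apply: lt_le_trans (truncnS_gt _) _.
    by rewrite -natrX ler_nat ltnW// ltn_expl.
  have cntx s := cnt x s Ax.
  have h1 := dyadic_kernel_sum f0 f_le lam0 lam_lt f_half delta0 r_gt0 K0
    cntx (le_trans dr rT) Tm (le_trans TR0 R0t).
  have {}h1 := h1 (le_trans (_ : 2 * T <= 2 * R0) R0r).
  rewrite ler_pM2l// in h1; have {}h1 := h1 TR0.
  have h2 : \sum_(y <- ys | ~~ (enorm (x - y) < T))
      truncated f delta (enorm (x - y)) <= f T * n.
    rewrite -sum_cst big_mkcond/=; apply: ler_sum => y _.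
    case: ifPn => [|_]; last exact: ltW.
    by rewrite -leNgt => Txy; apply: f_le => //; rewrite le_max Txy.
  apply: le_trans (lerD h1 h2) _; rewrite -/B -/n -mulrDl ler_wpM2r//.
  have : (T / r) `^ d <= 2 `^ d.
    apply: ge0_ler_powR; rewrite ?nnegrE ?(ltW d0)//.
      by rewrite divr_ge0 ?ltW.
    by rewrite ler_pdivrMr.
  move=> /(ler_wpM2l B0) h3; rewrite !mulrDl mul1r lerD2r.
  apply: le_trans (ler_wpM2r (ltW fT0) h3) _.
  by rewrite lerDl mulr_ge0 ?ltW.
have rt0 : r <= t0 by lra.
have Tt0 : T = t0 by rewrite /T max_l.
rewrite -sum_cst [leLHS]big_seq [leRHS]big_seq; apply: ler_sum => y yys.
have T20 : 0 < T / 2 by rewrite divr_gt0.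
apply: (@le_trans _ _ (f (T / 2))).
  apply: f_le => //; rewrite le_max Tt0; apply/orP; left.
  have [_ yr] := ysA y yys; have := enorm_triangle y x y0.
  by rewrite -/t0; lra.
apply: le_trans (f_half T T0 (le_trans TR0 R0t)) _.
rewrite ler_pM2r// -addrA addrC -addrA lerDl.
by rewrite addr_ge0// mulr_ge0// ltW.
Qed.

End KernelAverages.

(** * Truncated kernels and their potentials *)

Section ContinuousKernels.
Context {R : realType} {p : nat}.

Lemma enorm_coord (x : 'rV[R]_p) i : `|x ord0 i| <= enorm x.
Proof.
rewrite -(@ler_pXn2r _ 2)// ?nnegrE ?enorm_ge0// sqr_enorm real_normK ?num_real//.
rewrite (bigD1 i)//= lerDl; apply: sumr_ge0 => j _; exact: sqr_ge0.
Qed.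

Lemma nbhs_eball (y : 'rV[R]_p) (P : set 'rV[R]_p) : nbhs y P ->
  exists2 r : R, 0 < r & forall x, enorm (x - y) < r -> P x.
Proof.
move=> /nbhs_ballP[r /= r0 yP]; exists r => // x xy; apply: yP.
split=> // i j; rewrite (ord1 i) /ball/=.
apply: le_lt_trans xy; rewrite enormB; apply: le_trans (enorm_coord _ j).
by rewrite !mxE.
Qed.

(** Joint continuity of [g |x - y'|] in [(x, y')] together with the compactness of
    [A] gives the uniformity in [x]. *)
Lemma near_compact_uniform (A : set 'rV[R]_p) (g : R -> R) (y : 'rV[R]_p) (eta : R) :
  compact A -> continuous g -> 0 < eta ->
  \forall y' \near y, forall x, A x ->
    `|g (enorm (x - y')) - g (enorm (x - y))| <= eta.
Proof.
move=> /compact_near_coveringP cA cg eta0.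
apply: (cA _ (nbhs y) (fun y' x =>
  `|g (enorm (x - y')) - g (enorm (x - y))| <= eta)) => x0 Ax0.
have cG : (fun z : 'rV[R]_p * 'rV[R]_p => g (enorm (z.1 - z.2))) @ (x0, y) -->
    g (enorm (x0 - y)).
  apply: (@cvg_comp _ _ _ (fun z : 'rV[R]_p * 'rV[R]_p => enorm (z.1 - z.2)) g
    _ (nbhs (enorm (x0 - y)))); last exact: cg.
  apply: (@cvg_comp _ _ _ (fun z : 'rV[R]_p * 'rV[R]_p => z.1 - z.2) enorm
    _ (nbhs (x0 - y))); last exact: continuous_enorm.
  by apply: cvgB; [exact: cvg_fst|exact: cvg_snd].
have c1 : (fun x => g (enorm (x - y))) @ x0 --> g (enorm (x0 - y)).
  apply: (@cvg_comp _ _ _ (fun x : 'rV[R]_p => enorm (x - y)) g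
    _ (nbhs (enorm (x0 - y)))); last exact: cg.
  exact: continuous_enormB.
have e20 : 0 < eta / 2 by rewrite divr_gt0.
have h1 : \forall z \near (nbhs x0, nbhs y),
    `|g (enorm (x0 - y)) - g (enorm (z.1 - z.2))| < eta / 2.
  by move/cvgrPdist_lt : cG => /(_ _ e20).
have h2 : \forall z \near (nbhs x0, nbhs y),
    `|g (enorm (x0 - y)) - g (enorm (z.1 - y))| < eta / 2.
  exists ([set x | `|g (enorm (x0 - y)) - g (enorm (x - y))| < eta / 2], setT).
    split; last exact: filterT.
    by move/cvgrPdist_lt : c1 => /(_ _ e20).
  by move=> [x y'] [].
apply: filterS2 h1 h2 => -[x y'] /= h1 h2.
rewrite -(subrKA (g (enorm (x0 - y)))) (le_trans (ler_normD _ _))//.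
by rewrite (splitr eta) lerD// ltW// distrC.
Qed.

Lemma continuous_truncated (f : R -> R) (delta : R) :
  (forall t : R, 0 < t -> {for t, continuous f}) -> 0 < delta ->
  continuous (truncated f delta).
Proof.
move=> cf delta0 t.
apply: (@continuous_comp _ _ _ (fun t => Num.max t delta) f); last first.
  by apply: cf; rewrite lt_max delta0 orbT.
apply: (@continuous_max _ _ (fun t => t) (fun=> delta)).
  exact: cvg_id.
exact: cvg_cst.
Qed.

Lemma truncated_cvg_kernel0 (f : R -> R) (t : R) :
  (forall s t, 0 < s -> s <= t -> f t <= f s) -> 0 <= t ->
  (truncated f n.+1%:R^-1 t)%:E @[n --> \oo] --> kernel0 f t.
Proof.
move=> f_le; rewrite le_eqVlt => /predU1P[<-|t0]; rewrite /kernel0 /truncated.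
  rewrite eqxx.
  have cf : (f s)%:E @[s --> 0^'+] -->
      ereal_sup ((EFin \o f) @` [set` Interval (BRight 0) (BRight (1 : R))]).
    apply: nonincreasing_at_right_cvge; first by rewrite bnd_simp.
    move=> a b; rewrite !in_itv/= => /andP[a0 _] _ ab.
    by rewrite lee_fin f_le.
  have -> : lim ((f s)%:E @[s --> 0^'+]) =
      ereal_sup ((EFin \o f) @` [set` Interval (BRight 0) (BRight (1 : R))]).
    by apply/cvg_lim.
  apply: (@cvg_comp _ _ _ (fun n => Num.max 0 n.+1%:R^-1) (fun s => (f s)%:E)
    _ (0^'+)); last exact: cf.
  move=> P [e /= e0 hP].
  have := @cvg_harmonic R => /cvgrPdist_lt/(_ e e0); apply: filterS => n.
  rewrite /= max_r// => ne; apply: hP; first exact: ne.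
  by rewrite /= invr_gt0.
rewrite gt_eqF//; apply: cvg_near_cst.
have := @cvg_harmonic R => /cvgrPdist_lt/(_ t t0); apply: filterS => n.
rewrite sub0r normrN ger0_norm ?invr_ge0// => nt.
by rewrite max_l// ltW.
Qed.

End ContinuousKernels.

Section BorelSets.
Context {R : realType} {p : nat}.

Lemma rV_hausdorff : hausdorff_space 'rV[R]_p.
Proof. exact: norm_hausdorff. Qed.

Lemma compact_measurable_rV (A : set 'rV[R]_p) :
  compact A -> measurable (A : set (borel_rV R p)).
Proof.
move=> /(compact_closed rV_hausdorff) /closed_openC oA.
rewrite -[A]setCK; apply: measurableC.
exact: sub_sigma_algebra.
Qed.

Lemma continuous_measurable_rV (A : set (borel_rV R p)) (g : 'rV[R]_p -> R) :
  measurable A -> continuous g -> measurable_fun A (g : borel_rV R p -> R).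
Proof.
move=> mA /continuousP cg; apply: (measurability _ (measurable_realfun.RGenOpens.measurableE R)).
move=> _ [_ [a [b ->] <-]]; apply: measurableI => //.
by apply: sub_sigma_algebra; apply: cg; exact: interval_open.
Qed.

End BorelSets.

Section Potentials.
Context {R : realType} {p : nat}.
Variables (A : set 'rV[R]_p) (A_compact : compact A).
Implicit Types (mu : {finite_measure set (borel_rV R p) -> \bar R}).

Let mA : measurable (A : set (borel_rV R p)).
Proof. exact: compact_measurable_rV. Qed.

Lemma continuous_addr (g h : 'rV[R]_p -> R) :
  continuous g -> continuous h -> continuous (fun x => g x + h x).
Proof.
move=> cg ch x.
by apply: (@cvgD _ _ _ (nbhs x) _ g h); [exact: cg|exact: ch].
Qed.

Lemma continuous_scaler (a : R) (g : 'rV[R]_p -> R) :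
  continuous g -> continuous (fun x => a * g x).
Proof.
move=> cg x; apply: (@continuous_comp _ _ _ g (fun t => a * t)); first exact: cg.
exact: mulrl_continuous.
Qed.

Lemma continuous_integrable mu (g : 'rV[R]_p -> R) :
  continuous g -> mu.-integrable A (EFin \o g).
Proof.
move=> cg; apply: measurable_bounded_integrable => //.
- by rewrite -ge0_fin_numE ?fin_num_measure.
- exact: continuous_measurable_rV.
- have : compact (g @` A).
    by apply: continuous_compact => //; exact: continuous_subspaceT.
  move=> /compact_bounded[M [Mreal hM]]; exists M; split=> // x Mx y /= Ay.
  by apply: (hM x Mx); exists y.
Qed.

Lemma le_Rintegral_continuous mu (g h : 'rV[R]_p -> R) :
  continuous g -> continuous h -> (forall x, A x -> g x <= h x) ->
  \int[mu]_(x in A) g x <= \int[mu]_(x in A) h x.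
Proof.
by move=> cg ch gh; apply: le_Rintegral => //; exact: continuous_integrable.
Qed.

Lemma RintegralD_continuous mu (g h : 'rV[R]_p -> R) :
  continuous g -> continuous h ->
  \int[mu]_(x in A) (g x + h x) =
  \int[mu]_(x in A) g x + \int[mu]_(x in A) h x.
Proof. by move=> cg ch; rewrite RintegralD//; exact: continuous_integrable. Qed.

Lemma RintegralZ_continuous mu (g : 'rV[R]_p -> R) (a : R) : continuous g ->
  \int[mu]_(x in A) (a * g x) = a * \int[mu]_(x in A) g x.
Proof. by move=> cg; rewrite RintegralZl//; exact: continuous_integrable. Qed.

Definition mass mu : R := \int[mu]_(x in A) 1.

Lemma Rintegral_cst_mass mu (a : R) : \int[mu]_(x in A) a = a * mass mu.
Proof.
rewrite /mass -(@RintegralZ_continuous mu (fun=> 1)); last exact: cst_continuous.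
by apply: eq_Rintegral => x _; rewrite mulr1.
Qed.

Lemma mass_ge0 mu : 0 <= mass mu.
Proof. by apply: Rintegral_ge0 => x _; exact: ler01. Qed.

Lemma Rintegral_sum_continuous mu (T : Type) (s : seq T)
    (g : T -> 'rV[R]_p -> R) : (forall i, continuous (g i)) ->
  \int[mu]_(x in A) (\sum_(i <- s) g i x) =
  \sum_(i <- s) \int[mu]_(x in A) g i x.
Proof.
move=> cg; elim: s => [|i s IH].
  under eq_Rintegral => x _ do rewrite big_nil.
  by rewrite big_nil Rintegral_cst_mass mul0r.
under eq_Rintegral => x _ do rewrite big_cons.
rewrite big_cons -IH RintegralD_continuous//.
by apply: continuous_big => // x; exact: add_continuous.
Qed.

Variables (f : R -> R).
Hypothesis f_gt0 : forall t, 0 < t -> 0 < f t.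
Hypothesis f_le : forall s t, 0 < s -> s <= t -> f t <= f s.
Hypothesis f_cont : forall t : R, 0 < t -> {for t, continuous f}.

Definition truncated_potential (delta : R) mu (y : 'rV[R]_p) : R :=
  \int[mu]_(x in A) truncated f delta (enorm (x - y)).

Lemma continuous_truncated_enorm (delta : R) (y : 'rV[R]_p) : 0 < delta ->
  continuous (fun x : 'rV[R]_p => truncated f delta (enorm (x - y))).
Proof.
move=> delta0 x.
apply: (@continuous_comp _ _ _ (fun x : 'rV[R]_p => enorm (x - y))
  (truncated f delta)).
  exact: continuous_enormB.
exact: continuous_truncated.
Qed.

Lemma truncated_antitone (delta eta t : R) : 0 < delta -> delta <= eta ->
  truncated f eta t <= truncated f delta t.
Proof.
move=> delta0 de; apply: f_le; first by rewrite lt_max delta0 orbT.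
by rewrite ge_max !le_max lexx de orbT.
Qed.

Lemma truncated_potential_antitone (delta eta : R) mu y : 0 < delta ->
  delta <= eta -> truncated_potential eta mu y <= truncated_potential delta mu y.
Proof.
move=> delta0 de; apply: le_Rintegral_continuous => [||x _].
- by apply: continuous_truncated_enorm; exact: lt_le_trans de.
- exact: continuous_truncated_enorm.
- exact: truncated_antitone.
Qed.

(** Monotone convergence: the truncated kernels increase to the kernel, also at
    the point [x = y], where the kernel is its limit at 0. *)
Lemma truncated_potential_cvg mu y :
  (truncated_potential n.+1%:R^-1 mu y)%:E @[n --> \oo] --> potential A f mu y.
Proof.
have n0 n : 0 < n.+1%:R^-1 :> R by rewrite invr_gt0.
pose g (n : nat) (x : borel_rV R p) : \bar R :=
  (truncated f n.+1%:R^-1 (enorm ((x : 'rV[R]_p) - y)))%:E.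
have -> : (fun n => (truncated_potential n.+1%:R^-1 mu y)%:E) =
    (fun n => \int[mu]_(x in A) g n x)%E.
  apply/funext => n; rewrite /truncated_potential /Rintegral fineK//.
  apply: integrable_fin_num => //.
  by apply: continuous_integrable; exact: continuous_truncated_enorm.
rewrite /potential.
have -> : (\int[mu]_(x in A) kernel0 f (enorm ((x : 'rV[R]_p) - y)))%E =
    (\int[mu]_(x in A) (limn (g^~ x)))%E.
  apply: eq_integral => x _; apply/esym/cvg_lim => //.
  by apply: truncated_cvg_kernel0 => //; exact: enorm_ge0.
apply: cvg_monotone_convergence => //.
- move=> n; apply/measurable_realfun.measurable_EFinP; apply: continuous_measurable_rV => //.
  exact: continuous_truncated_enorm.
- move=> n x _; rewrite lee_fin ltW// f_gt0// lt_max n0 orbT//.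
- move=> x _ m n mn; rewrite lee_fin; apply: truncated_antitone => //.
  by rewrite lef_pV2 ?posrE// ler_nat.
Qed.

Lemma truncated_potential_le (delta : R) mu y : 0 < delta ->
  ((truncated_potential delta mu y)%:E <= potential A f mu y)%E.
Proof.
move=> delta0; apply: (cvge_to_ge (@truncated_potential_cvg mu y)).
have := @cvg_harmonic R => /cvgrPdist_lt/(_ delta delta0); apply: filterS => n.
rewrite sub0r normrN ger0_norm ?invr_ge0// => nd.
by rewrite lee_fin; apply: truncated_potential_antitone; rewrite ?invr_gt0// ltW.
Qed.

Lemma truncated_potential_gt (M : R) mu y : (M%:E < potential A f mu y)%E ->
  exists2 delta : R, 0 < delta & M < truncated_potential delta mu y.
Proof.
move=> MU; apply: contrapT => /forall2NP h.
have : (potential A f mu y <= M%:E)%E.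
  apply: (cvge_to_le (@truncated_potential_cvg mu y)).
  apply: nearW => n; rewrite lee_fin.
  have [] := h n.+1%:R^-1; first by rewrite invr_gt0.
  by move=> /negP; rewrite -leNgt.
by rewrite leNgt MU.
Qed.

End Potentials.

(** * Polarization along a weak-star convergent sequence *)

Section WeakStarLimits.
Context {R : realType} {p : nat}.
Variables (d : R) (A : set 'rV[R]_p) (f : R -> R).
Hypotheses (d_gt0 : 0 < d) (A_regular : regular_set d A) (f_riesz : riesz_like d f).
Implicit Types (mu nu : {finite_measure set (borel_rV R p) -> \bar R}).

Let A_compact : compact A. Proof. by case: A_regular. Qed.

Let f_gt0 t : 0 < t -> 0 < f t. Proof. by case: f_riesz => f0 _ _ _; exact: f0. Qed.

Let f_le s t : 0 < s -> s <= t -> f t <= f s.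
Proof.
case: f_riesz => _ _ f_dec _ s0.
by rewrite le_eqVlt => /predU1P[->//|st]; exact/ltW/f_dec.
Qed.

Let f_cont t : 0 < t -> {for t, continuous f}.
Proof. by case: f_riesz => _ fc _ _; exact: fc. Qed.

Local Notation V := (truncated_potential A f).

(** For one [y], some truncation already gives a value above [M] for [nu]; weak-star
    convergence carries it to [nu_ N], equicontinuity to the points near [y], and
    monotonicity to smaller truncations.  Compactness of [A] makes it uniform. *)
Lemma near_truncated_potential_gt
    (nu_ : nat -> {finite_measure set (borel_rV R p) -> \bar R}) nu (M : R) :
  weak_star_cvg A nu_ nu -> (forall y, A y -> (M%:E < potential A f nu y)%E) ->
  \forall N \near \oo & delta \near 0^'+,
    forall y, A y -> M < V delta (nu_ N) y.
Proof.
move=> nu_cvg MU; have /compact_near_coveringP cA := A_compact.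
apply: (cA (nat * R)%type (filter_prod \oo 0^'+)
  (fun Nd y => M < V Nd.2 (nu_ Nd.1) y)) => y Ay.
have [delta0 delta00 MV] :=
  truncated_potential_gt A_compact f_gt0 f_le f_cont (MU y Ay).
set e := V delta0 nu y - M.
have e0 : 0 < e by rewrite subr_gt0.
have m0 := mass_ge0 A nu.
(* With this [eta], an error [eta] in the kernel costs at most [e / 4] in the
   integral; the added 1 covers a zero mass and the masses of [nu_ N]. *)
pose eta := e / (4 * (mass A nu + 1)).
have m10 : 0 < 4 * (mass A nu + 1) by rewrite mulr_gt0// ltr_wpDl.
have eta0 : 0 < eta by rewrite divr_gt0.
have h1 := near_compact_uniform y A_compact
  (continuous_truncated f_cont delta00) eta0.
have h2 := nu_cvg _ (continuous_subspaceT
  (continuous_truncated_enorm f_cont (y := y) delta00)).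
have h3 := nu_cvg _ (continuous_subspaceT (@cst_continuous _ _ (1 : R))).
have e20 : 0 < e / 2 by rewrite divr_gt0.
move/cvgrPdist_lt : h2 => /(_ _ e20) h2.
move/cvgrPdist_lt : h3 => /(_ _ ltr01) h3.
eexists (_, _); first split; [exact: h1| |].
  exists ([set N | `|V delta0 nu y - V delta0 (nu_ N) y| < e / 2 /\
      `|mass A nu - mass A (nu_ N)| < 1], [set t | 0 < t <= delta0]).
    split=> /=; first exact: filterI.
    by exists delta0 => //= t /=; rewrite sub0r normrN => + t0;
      rewrite gtr0_norm// t0 => /ltW.
  exact: subset_refl.
move=> [y' [N delta]] /= [yy' [[hN hm] /andP[d0 dd0]]].
apply: lt_le_trans (truncated_potential_antitone A_compact f_le f_cont
  (nu_ N) y' d0 dd0).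
have : V delta0 (nu_ N) y <= V delta0 (nu_ N) y' + eta * mass A (nu_ N).
  have cy z := continuous_truncated_enorm f_cont (y := z) delta00.
  rewrite -Rintegral_cst_mass// -RintegralD_continuous//; last exact: cst_continuous.
  apply: le_Rintegral_continuous => //.
    by apply: continuous_addr; [exact: cy|exact: cst_continuous].
  by move=> x /yy'; rewrite ler_distl => /andP[]; lra.
have : eta * mass A (nu_ N) <= e / 4.
  have mN : mass A (nu_ N) <= mass A nu + 1.
    by move: hm; rewrite ltr_distlC => /andP[_ /ltW].
  apply: le_trans (ler_wpM2l (ltW eta0) mN) _.
  rewrite le_eqVlt; apply/orP; left; apply/eqP; rewrite /eta; field.
  by rewrite gt_eqF// ltr_wpDl.
move: hN; rewrite ltr_distlC => /andP[+ _]; move: MV; rewrite /e.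
move: (V delta0 nu y) (V delta0 (nu_ N) y) (V delta0 (nu_ N) y')
  (eta * mass A (nu_ N)) => a b c m.
by clear h1 h2 h3 yy' hm m0 m10 eta0 e0 e20; lra.
Qed.

(** If [f] is bounded, a truncated kernel at [y0] is uniformly within [eta] of [f],
    and the single point [y0] will do.  Otherwise fix a truncation radius [rad]
    for which [V rad nu y0] is close to the potential [u], and let [f_s] denote the
    kernel truncated at [s].  The function
      [Phi = f_rad + eta + 2 C0 (f_r - f_rad)]
    has integral at most [u + eta * mass + 2 C0 (u - V rad nu y0)], which is below
    [M].  It dominates the averages: where [|x - y0| < rad2] with
    [f rad2 >= 2 f rad], the difference [f_r - f_rad] is at least half of [f_r] and
    the average is at most [C0 f_r]; elsewhere moving [y0] by less than [r]
    changes the kernel by at most [eta], and [2 C0 >= 1]. *)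
Lemma dominating_averages nu y0 (M : R) : A y0 ->
  (potential A f nu y0 < M%:E)%E ->
  exists (Phi : 'rV[R]_p -> R) (r : R),
    [/\ continuous Phi, \int[nu]_(x in A) Phi x < M, 0 < r &
     forall delta, 0 < delta -> delta <= r -> exists ys : seq 'rV[R]_p,
       [/\ (0 < size ys)%N, forall y, y \in ys -> A y &
        forall x, A x -> \sum_(y <- ys) truncated f delta (enorm (x - y)) <=
          Phi x * (size ys)%:R]].
Proof.
move=> Ay0 UM.
have V_le (delta : R) : 0 < delta -> ((V delta nu y0)%:E <= potential A f nu y0)%E.
  by move=> delta0; exact: truncated_potential_le.
have [u Uu] : exists u : R, potential A f nu y0 = u%:E.
  move: UM (V_le 1 ltr01); case: (potential A f nu y0) => [u||]; [|by []|by []].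
  by exists u.
rewrite Uu lte_fin in UM.
have Vu (delta : R) : 0 < delta -> V delta nu y0 <= u.
  by move=> /V_le; rewrite Uu lee_fin.
set e := M - u.
have e0 : 0 < e by rewrite subr_gt0.
have m0 := mass_ge0 A nu.
pose eta := e / (4 * (mass A nu + 1)).
have m10 : 0 < 4 * (mass A nu + 1) by rewrite mulr_gt0// ltr_wpDl.
have eta0 : 0 < eta by rewrite divr_gt0.
have eta_mass : eta * mass A nu <= e / 4.
  have -> : e / 4 = eta * (mass A nu + 1).
    by rewrite /eta; field; rewrite gt_eqF// ltr_wpDl.
  by rewrite ler_pM2l// lerDl.
have ct (delta : R) : 0 < delta ->
    continuous (fun x : 'rV[R]_p => truncated f delta (enorm (x - y0))).
  exact: continuous_truncated_enorm.
have [bf|ubf] := pselect (has_ubound (f @` [set t | 0 < t])).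
  have hs : has_sup (f @` [set t | 0 < t]).
    by split=> //; exists (f 1), 1 => //=; exact: ltr01.
  have [_ [rad /= rad0 <-] supf] := sup_adherent eta0 hs.
  have f_near t : 0 < t -> f t <= f rad + eta.
    move=> t0; rewrite -lerBlDr; apply: le_trans (ltW supf).
    by rewrite lerD2r; apply: ub_le_sup => //; exists t.
  exists (fun x => truncated f rad (enorm (x - y0)) + eta), rad; split=> //.
  - by apply: continuous_addr; [exact: ct|exact: cst_continuous].
  - rewrite RintegralD_continuous// ?Rintegral_cst_mass//;
      [|exact: ct|exact: cst_continuous].
    by have := Vu _ rad0; rewrite /truncated_potential; move: eta_mass; rewrite /e; lra.
  - move=> delta delta0 delta_rad; exists [:: y0]; split=> //.
      by move=> y; rewrite inE => /eqP ->.
    move=> x Ax; rewrite big_seq1 mulr1 /truncated.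
    have [tr|rt] := leP (enorm (x - y0)) rad.
      by apply: f_near; rewrite lt_max delta0 orbT.
    rewrite (max_l (le_trans delta_rad (ltW rt))).
    by rewrite lerDl ltW.
have f_unbounded (B : R) : exists2 t, 0 < t & B < f t.
  apply: contrapT => /forall2NP h; apply: ubf; exists B => _ [t t0 <-].
  by have [/(_ t0)//|/negP] := h t; rewrite -leNgt.
have [C0 [R0 [C01 R00 averages]]] := kernel_average_bound d_gt0 A_regular f_riesz.
have C00 : 0 < C0 by exact: lt_le_trans C01.
(* The error [e / (8 C0)] becomes [e / 4] after multiplication by [2 C0]. *)
have [rad rad0 Vrad] : exists2 rad : R, 0 < rad & u - e / (8 * C0) < V rad nu y0.
  apply: truncated_potential_gt => //.
  by rewrite Uu lte_fin ltrBlDr ltrDl divr_gt0// mulr_gt0.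
have [t1 t10 ft1] := f_unbounded (2 * f rad).
pose rad2 := Num.min t1 R0.
have rad20 : 0 < rad2 by rewrite lt_min t10.
have rad2R0 : rad2 <= R0 by rewrite ge_min lexx orbT.
have f_rad2 : 2 * f rad <= f rad2.
  by apply: le_trans (ltW ft1) _; apply: f_le => //; rewrite ge_min lexx.
have f_rad0 := f_gt0 rad0.
(* Half of [rad2], so that for [|x - y0| >= rad2] the points [y] of the net, which
   are within [rad1] of [y0], stay at distance at least [rad1] from [x]. *)
pose rad1 := rad2 / 2.
have rad10 : 0 < rad1 by rewrite divr_gt0.
have [r1 r10 unif] := nbhs_eball (near_compact_uniform y0 A_compact
  (continuous_truncated f_cont rad10) eta0).
pose r := Num.min rad1 r1.
have r_gt0 : 0 < r by rewrite lt_min rad10.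
have r_rad1 : r <= rad1 by rewrite ge_min lexx.
have r_r1 : r <= r1 by rewrite ge_min lexx orbT.
have rad12 : rad1 + rad1 = rad2 by rewrite /rad1 -splitr.
(* The function [Phi] above, with the two terms in [f_rad] collected. *)
pose Phi (x : 'rV[R]_p) := (1 - 2 * C0) * truncated f rad (enorm (x - y0))
  + 2 * C0 * truncated f r (enorm (x - y0)) + eta.
exists Phi, r; split=> //.
- apply: continuous_addr; last exact: cst_continuous.
  by apply: continuous_addr; apply: continuous_scaler; exact: ct.
- rewrite /Phi.
  have cM (a delta : R) : 0 < delta ->
      continuous (fun x : 'rV[R]_p => a * truncated f delta (enorm (x - y0))).
    by move=> delta0; apply: continuous_scaler; exact: ct.
  rewrite RintegralD_continuous//; [|by apply: continuous_addr; exact: cM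
    |exact: cst_continuous].
  rewrite RintegralD_continuous//; [|exact: cM..].
  rewrite (RintegralZ_continuous A_compact nu _ (ct _ rad0)).
  rewrite (RintegralZ_continuous A_compact nu _ (ct _ r_gt0)).
  rewrite Rintegral_cst_mass//.
  have := Vu _ rad0; have := Vu _ r_gt0; have := Vrad.
  rewrite /truncated_potential.
  set a := Rintegral _ _ _; set b := Rintegral _ _ _ => ha hb hab.
  have h1 : 2 * C0 * (u - a) <= e / 4.
    have -> : e / 4 = 2 * C0 * (e / (8 * C0)) by field; rewrite gt_eqF.
    by rewrite ler_pM2l ?mulr_gt0//; lra.
  have h2 : 2 * C0 * (b - a) <= 2 * C0 * (u - a).
    by rewrite ler_pM2l ?mulr_gt0//; lra.
  by move: h1 h2 eta_mass; rewrite /e; lra.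
move=> delta delta0 delta_r.
have rR0 : r <= R0 by lra.
have [ys [ys0 ysA avg]] := averages y0 delta r Ay0 delta0 delta_r rR0.
exists ys; split=> //; first by move=> y /ysA[].
move=> x Ax; set n := (size ys)%:R.
have n0 : 0 <= n by exact: ler0n.
set t := enorm (x - y0).
have trunc_gt0 (s : R) : 0 < s -> 0 < truncated f s t.
  by move=> s0; apply: f_gt0; rewrite lt_max s0 orbT.
have [t_rad2|rad2_t] := ltP t rad2.
  have tR0 : t <= R0 by lra.
  apply: le_trans (avg x Ax tR0) _; apply: ler_wpM2r => //.
  have h1 : f rad2 <= truncated f r t.
    apply: f_le; first by rewrite lt_max r_gt0 orbT.
    by rewrite ge_max (ltW t_rad2)/=; lra.
  have h2 : truncated f rad t <= f rad.
    by apply: f_le => //; rewrite le_max lexx orbT.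
  rewrite /Phi -/t -/(truncated f r t).
  have h3 : 0 <= C0 * (truncated f r t - 2 * truncated f rad t).
    by rewrite mulr_ge0//; [exact: ltW|lra].
  by have := trunc_gt0 rad rad0; lra.
have r_le_rad : r <= rad.
  rewrite leNgt; apply/negP => /ltW rad_r.
  have := f_le rad0 (le_trans rad_r (_ : r <= rad2)).
  by move=> /(_ ltac:(lra)); lra.
have h1 : truncated f rad t <= truncated f r t by exact: truncated_antitone.
have -> : \sum_(y <- ys) truncated f delta (enorm (x - y)) =
  \sum_(y <- ys | y \in ys) truncated f delta (enorm (x - y)) by rewrite big_seq.
have -> : Phi x * n = \sum_(y <- ys | y \in ys) Phi x.
  by rewrite -big_seq big_const_seq count_predT iter_addr_0 mulr_natr.
apply: ler_sum => y /ysA[Ay yr].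
have xy : rad1 <= enorm (x - y).
  by have := enorm_triangle y x y0; rewrite -/t; lra.
have h2 : truncated f delta (enorm (x - y)) <= truncated f rad1 (enorm (x - y)).
  rewrite /truncated max_l; last by lra.
  by rewrite max_l.
have h3 : truncated f rad1 (enorm (x - y)) <= truncated f rad1 t + eta.
  have := unif y (lt_le_trans yr r_r1) x Ax.
  by rewrite ler_distl -/t => /andP[_].
have h4 : truncated f rad1 t = truncated f r t.
  by rewrite /truncated !max_l//; lra.
rewrite /Phi -/t.
have h5 : 0 <= (2 * C0 - 1) * (truncated f r t - truncated f rad t).
  by rewrite mulr_ge0//; lra.
lra.
Qed.

Variables (nu_ : nat -> {finite_measure set (borel_rV R p) -> \bar R})
  (nu : {finite_measure set (borel_rV R p) -> \bar R}).
Hypothesis nu_cvg : weak_star_cvg A nu_ nu.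

Lemma near_polarization_ge (M : R) : (M%:E < polarization A f nu)%E ->
  \forall N \near \oo, (M%:E <= polarization A f (nu_ N))%E.
Proof.
move=> MP.
have MU y : A y -> (M%:E < potential A f nu y)%E.
  by move=> Ay; apply: lt_le_trans MP _; apply: ereal_inf_lbound; exists y.
have [[W1 W2] /= [hW1 hW2] sub] := near_truncated_potential_gt nu_cvg MU.
apply: filterS hW1 => N W1N.
near (0 : R)^'+ => delta.
have W2d : W2 delta by near: delta.
have delta0 : 0 < delta by near: delta; exact: nbhs_right_gt.
apply: le_ereal_inf_tmp => _ [y Ay <-].
apply: le_trans (truncated_potential_le _ f_gt0 f_le f_cont _ _ delta0) => //.
by rewrite lee_fin ltW//; exact: (sub (N, delta)).
Unshelve. all: by end_near. Qed.

(** The averages of [dominating_averages] are taken at a truncation that depends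
    on [N], given by [near_truncated_potential_gt] for the constant sequence
    [nu_ N]; this is why [Phi] must dominate them for every truncation. *)
Lemma near_polarization_le (M : R) : (polarization A f nu < M%:E)%E ->
  \forall N \near \oo, (polarization A f (nu_ N) <= M%:E)%E.
Proof.
move=> /ereal_inf_lt[_ [y0 Ay0 <-]] UM.
have [Phi [r [cPhi PhiM r_gt0 dom]]] := dominating_averages Ay0 UM.
have := nu_cvg (continuous_subspaceT cPhi).
move=> /cvgr_lt/(_ _ PhiM); apply: filterS => N PhiNM.
rewrite leNgt; apply/negP => MP.
have MU y : A y -> (M%:E < potential A f (nu_ N) y)%E.
  by move=> Ay; apply: lt_le_trans MP _; apply: ereal_inf_lbound; exists y.
have cstN : weak_star_cvg A (fun=> nu_ N) (nu_ N) by move=> phi _; exact: cvg_cst.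
have [[W1 W2] /= [hW1 hW2] sub] := near_truncated_potential_gt cstN MU.
have [k W1k] := filter_ex hW1.
near (0 : R)^'+ => delta.
have W2d : W2 delta by near: delta.
have delta0 : 0 < delta by near: delta; exact: nbhs_right_gt.
have delta_r : delta <= r by near: delta; exact: nbhs_right_le.
have MV y : A y -> M < V delta (nu_ N) y by exact: (sub (k, delta)).
have [ys [ys0 ysA avg]] := dom delta delta0 delta_r.
have n0 : 0 < (size ys)%:R :> R by rewrite ltr0n.
have h1 : M * (size ys)%:R <= \sum_(y <- ys) V delta (nu_ N) y.
  rewrite mulr_natr -[leLHS]iter_addr_0 -count_predT -big_const_seq.
  rewrite big_seq [leRHS]big_seq; apply: ler_sum => y /ysA Ay.
  exact/ltW/MV.
have h2 : \sum_(y <- ys) V delta (nu_ N) y <=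
    (size ys)%:R * \int[nu_ N]_(x in A) Phi x.
  have cty y := continuous_truncated_enorm f_cont (y := y) delta0.
  rewrite /truncated_potential -Rintegral_sum_continuous//.
  rewrite -RintegralZ_continuous//; apply: le_Rintegral_continuous => //.
  - by apply: continuous_big => [|y _]; [exact: add_continuous|exact: cty].
  - exact: continuous_scaler.
  - by move=> x Ax; rewrite mulrC; exact: avg.
have := le_trans h1 h2.
by rewrite mulrC ler_pM2l// leNgt PhiNM.
Unshelve. all: by end_near. Qed.

End WeakStarLimits.

Theorem theorem1p8 (R : realType) (p : nat) (d : R) (A : set 'rV[R]_p)
    (f : R -> R)
    (nu_ : nat -> {finite_measure set (borel_rV R p) -> \bar R})
    (nu : {finite_measure set (borel_rV R p) -> \bar R})
    (d_gt0 : 0 < d) (d_le_p : d <= p%:R)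
    (A_regular : regular_set d A) (f_riesz : riesz_like d f)
    (nu_supp_N : forall N, supported_on A (nu_ N)) (nu_supp : supported_on A nu)
    (nu_cvg : weak_star_cvg A nu_ nu) :
  polarization A f (nu_ N) @[N --> \oo] --> polarization A f nu.
Proof.
have lower := near_polarization_ge A_regular f_riesz nu_cvg.
have upper := near_polarization_le d_gt0 A_regular f_riesz nu_cvg.
have P_ge0 : (0 <= polarization A f nu)%E.
  apply: le_ereal_inf_tmp => _ [y Ay <-].
  have [f0 fc fd _] := f_riesz; have [_ cA _ _] := A_regular.
  have f_le s t : 0 < s -> s <= t -> f t <= f s.
    by move=> s0; rewrite le_eqVlt => /predU1P[->//|st]; exact/ltW/fd.
  apply: le_trans (truncated_potential_le cA f0 f_le fc _ _ (@ltr01 R)).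
  rewrite lee_fin; apply: Rintegral_ge0 => x _; apply/ltW/f0.
  by rewrite lt_max ltr01 orbT.
move: P_ge0 lower upper; case: (polarization A f nu) => [u| |//] _ lower upper.
- have near_u (e : R) : 0 < e -> \forall N \near \oo,
      ((u - e)%:E <= polarization A f (nu_ N) <= (u + e)%:E)%E.
    move=> e0; have h1 := lower (u - e); have h2 := upper (u + e).
    rewrite !lte_fin ltrBlDr ltrDl in h1 h2.
    by apply: filterS2 (h1 e0) (h2 e0) => N -> ->.
  apply/fine_cvgP; split.
    apply: filterS (near_u 1 ltr01) => N /andP[h1 h2].
    by rewrite fin_numElt (lt_le_trans (ltNyr _) h1) (le_lt_trans h2 (ltry _)).
  apply/cvgrPdist_le => e e0; apply: filterS (near_u e e0) => N /=.
  case: (polarization A f (nu_ N)) => [v| |] /andP[] //=.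
  by rewrite !lee_fin => h1 h2; rewrite ler_distlC h1 h2.
- by apply/cvgeyPge => M; apply: lower; exact: ltry.
Qed.
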